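(* Let $k$ be a field and let $P=\{(0,0),(1,0),(0,1),(1,1)\}$ be the square poset with the product order. Let $M$ be the full interval module over $P$, i.e. the $P$-persistence module with $M_v=k$ for every $v\in P$ and with every structure map equal to the identity of $k$. Then $\mathrm{Ext}^1(M,M)=0$.
   Context: For a poset $P$, viewed as a small category with a unique morphism $p\to q$ whenever $p\le q$, a $P$-persistence module is a (covariant) functor $M:P\to\mathbf{Vec}_k$ to the category of $k$-vector spaces. For finite $P$, finite-dimensional $P$-persistence modules are identified with finite-dimensional modules over the incidence algebra $A=kP$, and $\mathrm{Ext}^i=\mathrm{Ext}^i_A$ is computed in this abelian category (equivalently, in the functor category). For the square poset, the covering relations are $f_x:(0,0)\to(1,0)$, $f_y:(0,0)\to(0,1)$, $g_y:(1,0)\to(1,1)$, $g_x:(0,1)\to(1,1)$, so a persistence module is a representation of this quiver subject to the commutativity relation $g_y\circ f_x=g_x\circ f_y$. *)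

(* Defs.v *)
From HB Require Import structures.
From mathcomp Require Import all_boot all_order all_algebra.
From mathcomp Require Import generic_quotient ring_quotient.
From mathcomp Require Import boolp.
From mathcomp Require Import freeg.

Set Implicit Arguments.
Unset Strict Implicit.
Unset Printing Implicit Defensive.

Import Order.TTheory GRing.Theory.

Local Open Scope ring_scope.
Local Open Scope quotient_scope.

(* The relation u <= v is boolean, hence proof-irrelevant: pm_map is indexed  *)
(* by the unique arrow u -> v of P seen as a category.                        *)
Record pmod (k : fieldType) (d : Order.disp_t) (P : porderType d) := PMod {
  pm_obj :> P -> lmodType k;
  pm_map : forall u v : P, (u <= v)%O -> {linear pm_obj u -> pm_obj v};
  pm_map_id : forall (u : P) (huu : (u <= u)%O) (x : pm_obj u),
    pm_map huu x = x;
  pm_map_comp : forall (u v w : P) (huv : (u <= v)%O) (hvw : (v <= w)%O)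
    (huw : (u <= w)%O) (x : pm_obj u),
    pm_map huw x = pm_map hvw (pm_map huv x)
}.

Record phom (k : fieldType) (d : Order.disp_t) (P : porderType d)
  (M N : pmod k P) := PHom {
  ph_fun :> forall u : P, {linear M u -> N u};
  ph_nat : forall (u v : P) (huv : (u <= v)%O) (x : M u),
    ph_fun v (pm_map M huv x) = pm_map N huv (ph_fun u x)
}.

Section Hom.
Context (k : fieldType) (d : Order.disp_t) (P : porderType d).
Implicit Types (L M N : pmod k P).

Lemma linear_eq (U V : lmodType k) (f g : {linear U -> V}) : f =1 g -> f = g.
Proof.
case: f => f [[[f1 f2]] [f3]]; case: g => g [[[g1 g2]] [g3]] /= fg.
have {}fg : f = g by apply: functional_extensionality_dep.
subst g; rewrite (Prop_irrelevance g1 f1) (Prop_irrelevance g2 f2).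
by rewrite (Prop_irrelevance g3 f3).
Qed.

Lemma phom_eq M N (f g : phom M N) : (forall u, f u =1 g u) -> f = g.
Proof.
case: f g => f fn [g gn] /= fg.
have {}fg : f = g by apply: functional_extensionality_dep => u; apply/linear_eq/fg.
by subst g; rewrite (Prop_irrelevance fn gn).
Qed.


Section HomOps.
Variables M N : pmod k P.
Implicit Types (f g : phom M N) (a : k).

Lemma phom_zero_nat u v (huv : (u <= v)%O) (x : M u) :
  (\0 : {linear M v -> N v}) (pm_map M huv x) =
  pm_map N huv ((\0 : {linear M u -> N u}) x).
Proof. by rewrite /= linear0. Qed.

Definition phom_zero : phom M N := PHom phom_zero_nat.

Lemma phom_add_nat f g u v (huv : (u <= v)%O) (x : M u) :
  (f v \+ g v) (pm_map M huv x) = pm_map N huv ((f u \+ g u) x).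
Proof. by rewrite /= !ph_nat linearD. Qed.

Definition phom_add f g : phom M N :=
  @PHom _ _ _ M N (fun u => f u \+ g u) (phom_add_nat f g).

Lemma phom_scale_nat a f u v (huv : (u <= v)%O) (x : M u) :
  (a \*: f v) (pm_map M huv x) = pm_map N huv ((a \*: f u) x).
Proof. by rewrite /= ph_nat linearZ. Qed.

Definition phom_scale a f : phom M N :=
  @PHom _ _ _ M N (fun u => a \*: f u) (phom_scale_nat a f).

Definition phom_opp f : phom M N := phom_scale (- 1) f.

HB.instance Definition _ := gen_eqMixin (phom M N).
HB.instance Definition _ := gen_choiceMixin (phom M N).

Lemma phom_addA : associative phom_add.
Proof. by move=> f g h; apply: phom_eq => u x; rewrite /= addrA. Qed.
Lemma phom_addC : commutative phom_add.
Proof. by move=> f g; apply: phom_eq => u x; rewrite /= addrC. Qed.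
Lemma phom_add0 : left_id phom_zero phom_add.
Proof. by move=> f; apply: phom_eq => u x; rewrite /= add0r. Qed.
Lemma phom_addN : left_inverse phom_zero phom_opp phom_add.
Proof. by move=> f; apply: phom_eq => u x; rewrite /= scaleN1r addNr. Qed.

HB.instance Definition _ := GRing.isZmodule.Build (phom M N)
  phom_addA phom_addC phom_add0 phom_addN.

Lemma phom_scaleA a b f : phom_scale a (phom_scale b f) = phom_scale (a * b) f.
Proof. by apply: phom_eq => u x; rewrite /= scalerA. Qed.
Lemma phom_scale1 : left_id 1 phom_scale.
Proof. by move=> f; apply: phom_eq => u x; rewrite /= scale1r. Qed.
Lemma phom_scaleDr : right_distributive phom_scale +%R.
Proof. by move=> a f g; apply: phom_eq => u x; rewrite /= scalerDr. Qed.
Lemma phom_scaleDl f : {morph phom_scale^~ f : a b / a + b}.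
Proof. by move=> a b; apply: phom_eq => u x; rewrite /= scalerDl. Qed.

HB.instance Definition _ := GRing.Zmodule_isLmodule.Build k (phom M N)
  phom_scaleA phom_scale1 phom_scaleDr phom_scaleDl.

Lemma phom0E u x : (0 : phom M N) u x = 0. Proof. by []. Qed.
Lemma phomDE f g u x : (f + g) u x = f u x + g u x. Proof. by []. Qed.
Lemma phomZE a f u x : (a *: f) u x = a *: f u x. Proof. by []. Qed.

End HomOps.

Lemma phom_comp_nat L M N (g : phom M N) (f : phom L M) u v
  (huv : (u <= v)%O) (x : L u) :
  (g v \o f v) (pm_map L huv x) = pm_map N huv ((g u \o f u) x).
Proof. by rewrite /= !ph_nat. Qed.

Definition phom_comp L M N (g : phom M N) (f : phom L M) : phom L N :=
  @PHom _ _ _ L N (fun u => g u \o f u) (phom_comp_nat g f).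

Definition precomp L M N (f : phom L M) (g : phom M N) : phom L N :=
  phom_comp g f.

Lemma precomp_linear L M N (f : phom L M) : linear (@precomp L M N f).
Proof. by move=> a g h; apply: phom_eq. Qed.

HB.instance Definition _ L M N (f : phom L M) :=
  GRing.isLinear.Build k (phom M N) (phom L N) *:%R (@precomp L M N f)
    (@precomp_linear L M N f).

Lemma phom_kerP M N (f : phom M N) u a (x y : M u) :
  f u x = 0 -> f u y = 0 -> f u (a *: x + y) = 0.
Proof. by move=> hx hy; rewrite linearP hx hy scaler0 addr0. Qed.

Lemma phom_ker_map M N (f : phom M N) u v (huv : (u <= v)%O) (x : M u) :
  f u x = 0 -> f v (pm_map M huv x) = 0.
Proof. by move=> hx; rewrite ph_nat hx linear0. Qed.

(* Epimorphisms, kernels and images in the functor category are pointwise.   *)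
Definition phom_epi L M (f : phom L M) : Prop :=
  forall (u : P) (y : M u), exists x : L u, f u x = y.

Definition phom_exact L M N (f : phom L M) (g : phom M N) : Prop :=
  forall (u : P) (y : M u), g u y = 0 <-> exists x : L u, f u x = y.

Definition projective (Q : pmod k P) : Prop :=
  forall (M N : pmod k P) (g : phom M N) (f : phom Q N), phom_epi g ->
  exists h : phom Q M, phom_comp g h = f.

End Hom.

Record resolution (k : fieldType) (d : Order.disp_t) (P : porderType d)
  (M : pmod k P) := Resolution {
  res_obj :> nat -> pmod k P;
  res_d : forall i : nat, phom (res_obj i.+1) (res_obj i);
  res_aug : phom (res_obj 0%N) M;
  res_projective : forall i : nat, projective (res_obj i);
  res_aug_epi : phom_epi res_aug;
  res_exact0 : phom_exact (res_d 0%N) res_aug;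
  res_exact : forall i : nat, phom_exact (res_d i.+1) (res_d i)
}.

Arguments res_aug_epi {k d P M} r u y.
Arguments res_exact0 {k d P M} r u y.
Arguments res_exact {k d P M} r i u y.

Section Quotient.
Context (k : fieldType) (V : lmodType k) (B : submodClosed V).

(* submodClosed is also meant for semirings, hence does not extend zmodClosed. *)
Lemma submod_zmod_closed : zmod_closed B.
Proof.
by split=> [|x y Bx By]; [apply: rpred0 | rewrite -scaleN1r rpredD ?rpredZ].
Qed.

Definition zmod_of_submod : zmodClosed V :=
  HB.pack_for (zmodClosed V) (GRing.SubmodClosed.sort B)
    (GRing.isZmodClosed.Build V (GRing.SubmodClosed.sort B) submod_zmod_closed).

Definition lmod_quot := Quotient.quot zmod_of_submod.

HB.instance Definition _ := ZmodQuotient.on lmod_quot.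

Local Notation Q := lmod_quot.

Definition quot_scale (a : k) : Q -> Q := lift_op1 Q ( *:%R a).

Lemma pi_quot_scale a : {morph \pi_Q : x / a *: x >-> quot_scale a x}.
Proof.
move=> x; unlock quot_scale; apply/eqP; rewrite piE Quotient.equivE -scalerBr.
apply: (@rpredZ _ _ B); rewrite -[_ \in _](Quotient.equivE zmod_of_submod).
by have /eqP := esym (reprK (\pi_Q x)); rewrite piE.
Qed.

Canonical pi_quot_scale_morph a := PiMorph1 (pi_quot_scale a).

Lemma quot_scaleA a b x : quot_scale a (quot_scale b x) = quot_scale (a * b) x.
Proof. by rewrite -[x]reprK -!pi_quot_scale scalerA. Qed.
Lemma quot_scale1 : left_id 1 quot_scale.
Proof. by move=> x; rewrite -[x]reprK -!pi_quot_scale scale1r. Qed.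
Lemma quot_scaleDr : right_distributive quot_scale +%R.
Proof.
move=> a x y; rewrite -[x]reprK -[y]reprK -!pi_quot_scale -!(raddfD \pi_Q).
by rewrite -pi_quot_scale scalerDr.
Qed.
Lemma quot_scaleDl x : {morph quot_scale^~ x : a b / a + b}.
Proof.
by move=> a b; rewrite -[x]reprK -!pi_quot_scale -(raddfD \pi_Q) scalerDl.
Qed.

HB.instance Definition _ := GRing.Zmodule_isLmodule.Build k Q
  quot_scaleA quot_scale1 quot_scaleDr quot_scaleDl.

End Quotient.

(* The cohomology of the cochain complex                                      *)
(*   0 -> Hom(R 0, N) -> Hom(R 1, N) -> Hom(R 2, N) -> ...                    *)
Section Cohomology.
Context (k : fieldType) (d : Order.disp_t) (P : porderType d).
Variables (M : pmod k P) (R : resolution M) (N : pmod k P).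

Local Notation hom_d i := (@precomp _ _ _ _ _ N (res_d R i)).

Definition is_coboundary (i : nat) : phom (R i) N -> Prop :=
  match i return phom (R i) N -> Prop with
  | 0%N => fun f => f = 0
  | j.+1 => fun f => exists g : phom (R j) N, hom_d j g = f
  end.

Lemma is_coboundaryP i a (f g : phom (R i) N) :
  is_coboundary f -> is_coboundary g -> is_coboundary (a *: f + g).
Proof.
case: i f g => [|i] f g /=; first by move=> -> ->; rewrite scaler0 addr0.
by move=> [f' <-] [g' <-]; exists (a *: f' + g'); rewrite linearP.
Qed.

Definition cocycle (i : nat) : {pred phom (R i) N} :=
  fun f => hom_d i f == 0.

Lemma cocycle_closed i : submod_closed (@cocycle i).
Proof.
split=> [|a f g /eqP hf /eqP hg]; apply/eqP; first exact: linear0.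
by rewrite linearP /= hf hg scaler0 addr0.
Qed.

HB.instance Definition _ i :=
  GRing.isSubmodClosed.Build k (phom (R i) N) (@cocycle i) (cocycle_closed i).

Definition cocycles (i : nat) := {f : phom (R i) N | cocycle f}.

HB.instance Definition _ i := SubChoice.on (cocycles i).
HB.instance Definition _ i := [SubChoice_isSubLmodule of cocycles i by <:].

Definition coboundary (i : nat) : {pred cocycles i} :=
  fun f => `[< is_coboundary (val f) >].

Lemma coboundary_closed i : submod_closed (@coboundary i).
Proof.
split=> [|a f g /asboolP hf /asboolP hg]; apply/asboolP.
  by case: i => [|i] //; exists 0; rewrite linear0.
by rewrite linearP; apply: is_coboundaryP.
Qed.

HB.instance Definition _ i :=
  GRing.isSubmodClosed.Build k (cocycles i) (@coboundary i)
    (coboundary_closed i).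

Definition Ext_res (i : nat) : lmodType k := @lmod_quot k (cocycles i) (@coboundary i).

End Cohomology.

Section FreeLift.
Context (k : fieldType) (K : choiceType) (V : lmodType k) (f : K -> V).

Lemma fglift_linear : linear (fglift f : {freeg K / k} -> V).
Proof.
have fgliftD : {morph fglift f : x y / x + y}.
  by move=> x y; have := lift_is_additive f x (- y);
     have := lift_is_additive f 0 y; have := lift_is_additive f 0 0;
     rewrite !subr0 subrr sub0r opprK => -> -> ->; rewrite sub0r opprK.
have fglift0 : fglift f 0 = 0.
  by have := lift_is_additive f 0 0; rewrite !subrr.
move=> a x y; rewrite fgliftD; congr (_ + _).
elim/freeg_ind_dom0: x => [|c z x _ _ IHx]; first by rewrite scaler0 fglift0 scaler0.
rewrite scalerDr !fgliftD IHx scalerDr; congr (_ + _).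
have -> : a *: << c *g z >> = << a * c *g z >> :> {freeg K / k}.
  by apply/eqP/freeg_eqP => t; rewrite coeffZ !coeffU mulrA.
by rewrite !liftU scalerA.
Qed.

HB.instance Definition _ :=
  GRing.isLinear.Build k {freeg K / k} V *:%R (fglift f) fglift_linear.

Lemma fgliftE z : fglift f << z >> = f z.
Proof. by rewrite liftU scale1r. Qed.

End FreeLift.

Lemma freeg_linear_eq (k : fieldType) (K : choiceType) (V : lmodType k)
  (f g : {linear {freeg K / k} -> V}) :
  (forall z, f << z >> = g << z >>) -> f =1 g.
Proof.
move=> fg x; elim/freeg_ind_dom0: x => [|c z x _ _ IHx]; first by rewrite !linear0.
have -> : << c *g z >> = c *: << z >> :> {freeg K / k}.
  by apply/eqP/freeg_eqP => t; rewrite coeffZ !coeffU mul1r.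
by rewrite !linearP IHx fg.
Qed.

(* The free module on generators x in M u, for all u and all x with S u x:    *)
(* the direct sum of the representable modules k[u, -) over all pairs (u, x). *)
Section Free.
Context (k : fieldType) (d : Order.disp_t) (P : porderType d).
Variables (M : pmod k P) (S : forall u : P, M u -> Prop).

Definition gens (v : P) :=
  {x : {u : P & M u} | `[< S (tagged x) >] && (tag x <= v)%O}.

Lemma gens_le_subproof u v (huv : (u <= v)%O) (x : gens u) :
  `[< S (tagged (val x)) >] && (tag (val x) <= v)%O.
Proof. by case/andP: (valP x) => -> /le_trans ->. Qed.

Definition gens_le u v (huv : (u <= v)%O) (x : gens u) : gens v :=
  exist _ (val x) (gens_le_subproof huv x).

Definition free_obj (v : P) : lmodType k := {freeg (gens v) / k}.

Definition free_map u v (huv : (u <= v)%O) : {linear free_obj u -> free_obj v} :=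
  fglift (fun x : gens u => << gens_le huv x >> : {freeg (gens v) / k}).

Lemma free_mapE u v (huv : (u <= v)%O) (z : gens u) :
  free_map huv << z >> = << gens_le huv z >>.
Proof. exact: fgliftE. Qed.

Lemma free_map_id u (huu : (u <= u)%O) (x : free_obj u) : free_map huu x = x.
Proof.
apply: (@freeg_linear_eq _ _ _ (free_map huu) idfun) => z.
by rewrite free_mapE; congr << _ >>; apply: val_inj.
Qed.

Lemma free_map_comp u v w (huv : (u <= v)%O) (hvw : (v <= w)%O)
  (huw : (u <= w)%O) (x : free_obj u) :
  free_map huw x = free_map hvw (free_map huv x).
Proof.
apply: (@freeg_linear_eq _ _ _ (free_map huw) (free_map hvw \o free_map huv)) => z.
by rewrite /= !free_mapE; congr << _ >>; apply: val_inj.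
Qed.

Definition free : pmod k P := PMod free_map_id free_map_comp.

Lemma gens_tag_le v (x : gens v) : (tag (val x) <= v)%O.
Proof. by case/andP: (valP x). Qed.

Lemma gens_prop v (x : gens v) : S (tagged (val x)).
Proof. by case/andP: (valP x) => /asboolP. Qed.

Lemma gen_subproof u (y : M u) (Sy : S y) :
  let x : {u : P & M u} := existT _ u y in
  `[< S (tagged x) >] && (tag x <= u)%O.
Proof. by rewrite /= lexx andbT; apply/asboolP. Qed.

Definition gen u (y : M u) (Sy : S y) : gens u :=
  exist _ (existT _ u y) (gen_subproof Sy).

Section Lift.
Variable N : pmod k P.
Variable f : forall x : {u : P & M u}, S (tagged x) -> N (tag x).

Definition free_lift_fun v : {linear free v -> N v} :=
  fglift (fun x : gens v => pm_map N (gens_tag_le x) (f (gens_prop x))).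

Lemma free_lift_funE v (z : gens v) :
  free_lift_fun v << z >> = pm_map N (gens_tag_le z) (f (gens_prop z)).
Proof. exact: fgliftE. Qed.

Lemma free_lift_nat u v (huv : (u <= v)%O) (x : free u) :
  free_lift_fun v (pm_map free huv x) = pm_map N huv (free_lift_fun u x).
Proof.
apply: (@freeg_linear_eq _ _ _ (free_lift_fun v \o pm_map free huv)
         (pm_map N huv \o free_lift_fun u)) => z.
rewrite /= free_mapE !free_lift_funE -(pm_map_comp _ _ (gens_tag_le (gens_le huv z))) /=.
by congr (pm_map _ _ (f _)); apply: Prop_irrelevance.
Qed.

Definition free_lift : phom free N := PHom free_lift_nat.

End Lift.

Definition free_aug : phom free M :=
  free_lift (fun (x : {u : P & M u}) (_ : S (tagged x)) => tagged x).

Lemma free_projective : projective free.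
Proof.
move=> A B g f gepi.
have hP (x : {u : P & M u}) (Sx : S (tagged x)) :=
  cid (gepi (tag x) (f (tag x) (<< gen Sx >> : {freeg _ / k}))).
exists (free_lift (fun x Sx => projT1 (hP x Sx))).
apply: phom_eq => u; apply: (@freeg_linear_eq _ _ _
  (phom_comp g (free_lift (fun x Sx => projT1 (hP x Sx))) u) (f u)) => z.
rewrite /= fgliftE ph_nat (svalP (hP _ _)) -ph_nat.
rewrite free_mapE.
by congr (f u << _ >>); apply: val_inj => /=; case: (sval z).
Qed.

Hypothesis S0 : forall u, S (0 : M u).
Hypothesis SP : forall u a (x y : M u), S x -> S y -> S (a *: x + y).
Hypothesis Smap : forall u v (huv : (u <= v)%O) (x : M u),
  S x -> S (pm_map M huv x).

Lemma free_augP u (y : M u) : S y <-> exists x : free u, free_aug u x = y.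
Proof.
split=> [Sy|[x <-]].
  by exists (<< gen Sy >> : {freeg _ / k}); rewrite /= fgliftE pm_map_id.
elim/freeg_ind_dom0: x => [|c z x _ _ IHx]; first by rewrite linear0.
have -> : << c *g z >> = c *: << z >> :> {freeg (gens u) / k}.
  by apply/eqP/freeg_eqP => t; rewrite coeffZ !coeffU mul1r.
rewrite linearP; apply: SP => //=.
by rewrite fgliftE; apply/Smap/gens_prop.
Qed.

End Free.

Section FreeResolution.
Context (k : fieldType) (d : Order.disp_t) (P : porderType d).
Variable M : pmod k P.

(* A stage is the last module built so far, with the submodule still to be    *)
(* covered: M itself at first, then the kernel of the last map.               *)
Definition stage : Type := {L : pmod k P & forall u : P, L u -> Prop}.

Definition next_stage (s : stage) : stage :=
  existT _ (free (projT2 s)) (fun u x => free_aug (projT2 s) u x = 0).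

Fixpoint res_stage (i : nat) : stage :=
  if i is j.+1 then next_stage (res_stage j)
  else existT _ M (fun u x => True).

Lemma res_stageP i u (y : projT1 (res_stage i) u) :
  projT2 (res_stage i) u y <->
  exists x : free (projT2 (res_stage i)) u, free_aug (projT2 (res_stage i)) u x = y.
Proof.
apply: free_augP; case: i {y} => [|i] //.
- by move=> v; apply: linear0.
- by move=> v a x y; apply: phom_kerP.
- by move=> v w hvw x; apply: phom_ker_map.
Qed.

Definition free_resolution : resolution M :=
  @Resolution k d P M
    (fun i => projT1 (res_stage i.+1))
    (fun i => free_aug (projT2 (res_stage i.+1)))
    (free_aug (projT2 (res_stage 0)))
    (fun i => @free_projective k d P _ _)
    (fun u y => iffLR (@res_stageP 0 u y) I)
    (fun u y => @res_stageP 1 u y)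
    (fun i u y => @res_stageP i.+2 u y).

End FreeResolution.

(* Ext^i(M, N), computed with the free resolution above.                      *)
Definition Ext (k : fieldType) (d : Order.disp_t) (P : porderType d) (i : nat)
  (M N : pmod k P) : lmodType k := Ext_res (free_resolution M) N i.

Section FullModule.
Context (k : fieldType) (d : Order.disp_t) (P : porderType d).

Definition full_map (u v : P) (_ : (u <= v)%O) : {linear k^o -> k^o} := idfun.

Definition full_module : pmod k P :=
  @PMod k d P (fun=> k^o) full_map
    (fun _ _ _ => erefl) (fun _ _ _ _ _ _ _ => erefl).

End FullModule.

(* {0, 1} x {0, 1} with the product order. *)
Definition square : finPOrderType _ := ('I_2 *p 'I_2)%type.

(* Main.v *)
(* The square has a least element 0, so M is the projective module k[0, -)    *)
(* represented by it (Yoneda). Hence the augmentation of a resolution of M    *)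
(* splits by some s, and a 1-cocycle f extends along the first differential d *)
(* by sending y to f x, for any x with d x = y - s (aug y).                   *)
From HB Require Import structures.
Require Import Defs.
From mathcomp Require Import all_boot all_order all_algebra.
From mathcomp Require Import generic_quotient ring_quotient.
From mathcomp Require Import boolp.
Import GRing.Theory.
Local Open Scope ring_scope.
Local Open Scope quotient_scope.

Set Implicit Arguments.
Unset Strict Implicit.
Unset Printing Implicit Defensive.

(** The first [Ext] out of a projective module vanishes for any resolution and any target
    ([Ext_res1_projective]). [full_module] is projective as soon as the poset has a least element,
    since a map out of it is fixed by the image of [1] there ([full_module_projective]). *)

Lemma lmod_quot_eq0 (k : fieldType) (V : lmodType k) (B : submodClosed V) :
  (forall v : V, v \in (B : {pred V})) -> forall x : lmod_quot B, x = 0.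
Proof.
move=> BT x; rewrite -[x]reprK; apply/eqP.
by rewrite piE Quotient.equivE; apply: BT.
Qed.

Section Projective.
Context {k : fieldType} {d : Order.disp_t} {P : porderType d}.

Definition phom_id (M : pmod k P) : phom M M :=
  @PHom _ _ _ M M (fun=> idfun) (fun _ _ _ _ => erefl).

(** The map [g] is [f] after [q]-inverse after [p]. Since [f] kills the kernel of [q], the chosen
    preimage does not matter ([gE]); linearity and naturality of [g] both follow from this
    independence. *)
Lemma phom_factor (K L M N : pmod k P) (p : phom K M) (q : phom L M)
    (f : phom L N) :
  (forall u y, exists x, q u x = p u y) ->
  (forall u x, q u x = 0 -> f u x = 0) ->
  exists g : phom K N, forall u x y, q u x = p u y -> g u y = f u x.
Proof.
move=> pq qf.
pose g u y := f u (sval (cid (pq u y))).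
have gE u x y : q u x = p u y -> g u y = f u x.
  rewrite /g; case: cid => x' /= <- e; apply/eqP.
  by rewrite eq_sym -subr_eq0 -linearB; apply/eqP/qf; rewrite linearB /= e subrr.
have glin u : linear (g u).
  move=> a y z; have [x ex] := pq u y; have [w ew] := pq u z.
  rewrite (gE u x y ex) (gE u w z ew) -linearP; apply: gE.
  by rewrite !linearP ex ew.
pose gL u : {linear K u -> N u} :=
  HB.pack (g u) (GRing.isLinear.Build _ _ _ _ (g u) (glin u)).
have gnat u v (huv : (u <= v)%O) (y : K u) :
    gL v (pm_map K huv y) = pm_map N huv (gL u y).
  have [x ex] := pq u y; rewrite /= (gE u x y ex) -ph_nat.
  by apply: gE; rewrite !ph_nat ex.
by exists (PHom gnat).
Qed.

Lemma Ext_res1_projective (M N : pmod k P) (R : resolution M) :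
  projective M -> forall x : Ext_res R N 1, x = 0.
Proof.
move=> Mproj; apply: lmod_quot_eq0 => -[f fP]; apply/asboolP => /=.
have [s sE] := Mproj _ _ _ (phom_id M) (res_aug_epi R).
have {}sE u x : res_aug R u (s u x) = x.
  exact: (congr1 (fun h : phom M M => h u x) sE).
(* The projection onto the kernel of the augmentation along the image of [s]; by exactness it lands
   in the image of [res_d R 0]. *)
pose p : phom (R 0%N) (R 0%N) := phom_id (R 0%N) - phom_comp s (res_aug R).
have pE u y : p u y = y - s u (res_aug R u y).
  by rewrite /p phomDE /= scaleN1r.
have [u y|u x /(res_exact R 0 u x) [z <-]|g gE] :=
    @phom_factor _ _ _ _ p (res_d R 0) f.
- by apply/(res_exact0 R); rewrite pE linearB /= sE subrr.
(* The cocycle condition says that [f] kills the image of [res_d R 1], which is the kernel of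
   [res_d R 0]. *)
- exact: (congr1 (fun h : phom (R 2) N => h u z) (eqP fP)).
exists g; apply: phom_eq => u x; apply: gE.
(* [p] fixes the image of [res_d R 0], so [x] itself serves as the preimage. *)
rewrite pE; have -> : res_aug R u (res_d R 0 u x) = 0.
  by apply/(res_exact0 R); exists x.
by rewrite linear0 subr0.
Qed.

Lemma full_module_projective (b : P) :
  (forall u, (b <= u)%O) -> projective (full_module k P).
Proof.
move=> bP M N g f gepi; have [x gx] := gepi b (f b 1).
(* The Yoneda map attached to [x], the chosen lift of [f b 1]. *)
pose h u (a : k^o) : M u := a *: pm_map M (bP u) x.
have hlin u : linear (h u) by move=> c a1 a2; rewrite /h scalerDl scalerA.
pose hL u : {linear full_module k P u -> M u} :=
  HB.pack (h u) (GRing.isLinear.Build _ _ _ _ (h u) (hlin u)).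
have hnat u v (huv : (u <= v)%O) (a : full_module k P u) :
    hL v (pm_map (full_module k P) huv a) = pm_map M huv (hL u a).
  by rewrite /= /h linearZ -(pm_map_comp (bP u) huv (bP v)).
exists (PHom hnat); apply: phom_eq => u a.
rewrite /= /h linearZ /= ph_nat gx -ph_nat /= -linearZ; congr (f u _).
exact: mulr1.
Qed.

End Projective.

Theorem proposition5p1 (k : fieldType)
  (x : Ext 1%N (full_module k square) (full_module k square)) : x = 0.
Proof.
apply: Ext_res1_projective; apply: (@full_module_projective _ _ _ ((ord0, ord0) : square)).
by move=> [i j]; rewrite Order.ProdOrder.leEprod /= !leEord.
Qed.
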